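(* Let $\mathcal{H}$ be a complex Hilbert space and let $f:\mathbb{D}\to\mathcal{B}(\mathcal{H})$ be an operator valued bounded holomorphic function with expansion $f(z)=\sum_{k=0}^{\infty}A_kz^k$ in $\mathbb{D}$, where $A_k\in\mathcal{B}(\mathcal{H})$ for all $k\ge 0$ and $A_0=a_0I$ with $a_0\in\mathbb{C}$, $|a_0|<1$. If $\|f(z)\|\le 1$ in $\mathbb{D}$, then $$\sum_{k=0}^{\infty}\|A_k\|r^k+\left(\frac{1}{1+\|f(0)\|}+\frac{r}{1-r}\right)\sum_{k=1}^{\infty}\|A_k\|^2r^{2k}\le 1\qquad\text{for } |z|=r\le\frac13 .$$ The constant $1/3$ is the best possible, i.e. for every $r\in(1/3,1)$ there is a holomorphic function $f:\mathbb{D}\to\mathcal{B}(\mathcal{H})$, $f(z)=\sum_{k=0}^{\infty}A_kz^k$, with $A_k\in\mathcal{B}(\mathcal{H})$ for all $k\ge 0$, $A_0=a_0I$ for some $a_0\in\mathbb{C}$, $|a_0|<1$, and $\|f(z)\|\le 1$ in $\mathbb{D}$, for which the inequality fails.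
   Context: $\mathbb{D}=\{z\in\mathbb{C}:|z|<1\}$; $\mathcal{B}(\mathcal{H})$ is the algebra of all bounded linear operators on $\mathcal{H}$ with the operator norm $\|\cdot\|$; $I$ is the identity operator on $\mathcal{H}$. *)

(* Defs.v *)
From HB Require Import structures.
From mathcomp Require Import all_boot all_order all_algebra complex.
From mathcomp Require Import all_classical all_reals all_analysis.

Set Implicit Arguments.
Unset Strict Implicit.
Unset Printing Implicit Defensive.

Import Order.TTheory GRing.Theory Num.Theory.
Import numFieldNormedType.Exports.

Local Open Scope classical_set_scope.
Local Open Scope ring_scope.
Local Open Scope complex_scope.

Lemma Re_normC (R : realType) (a : R[i]) : (complex.Re `|a|)%:C = `|a|.
Proof. by rewrite RRe_real// normr_real. Qed.

Lemma Re_normC_ge0 (R : realType) (a : R[i]) : 0 <= complex.Re `|a|.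
Proof. by rewrite -lecR Re_normC (normr_ge0 a). Qed.

(* In a normed module over R[i] the norm is R[i]-valued (and real). *)
Definition rnorm (R : realType) (V : normedModType R[i]) (x : V) : R :=
  complex.Re `|x|.

Section RealNorm.
Variables (R : realType) (V : normedModType R[i]).
Implicit Types x y : V.

Lemma rnormE x : (rnorm x)%:C = `|x|.
Proof. by rewrite RRe_real// normr_real. Qed.

Lemma rnorm_ge0 x : 0 <= rnorm x.
Proof. by rewrite -lecR rnormE normr_ge0. Qed.

Lemma rnorm0 : rnorm (0 : V) = 0.
Proof. by apply: (@complexI R); rewrite rnormE normr0. Qed.

Lemma rnorm_eq0 x : rnorm x = 0 -> x = 0.
Proof. by move=> x0; apply/normr0_eq0; rewrite -rnormE x0. Qed.

Lemma ler_rnormD x y : rnorm (x + y) <= rnorm x + rnorm y.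
Proof. by rewrite -lecR rmorphD/= !rnormE ler_normD. Qed.

Lemma rnormZ (a : R[i]) x : rnorm (a *: x) = complex.Re `|a| * rnorm x.
Proof.
apply: (@complexI R).
by rewrite rnormE normrZ -[LHS](congr1 ( *%R^~ `|x|) (Re_normC a)) -rnormE -rmorphM.
Qed.

End RealNorm.

Section BoundedOperators.
Variables (R : realType) (V : normedModType R[i]).

Definition bounded_linear : {pred V -> V} :=
  fun T => `[< linear T /\
               exists M : R, forall x, rnorm (T x) <= M * rnorm x >].

Lemma bounded_linear_submod_closed : submod_closed bounded_linear.
Proof.
have z0 x : (0 : V -> V) x = 0 by [].
split=> [|a S T /asboolP[Sl [M SM]] /asboolP[Tl [N TN]]]; apply/asboolP; split.
- by move=> a x y; rewrite !z0 scaler0 addr0.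
- by exists 0 => x; rewrite z0 mul0r rnorm0.
- move=> b x y.
  rewrite !fctE Sl Tl !scalerDr !scalerA addrACA.
  by congr (_ *: _ + _ + _); exact: mulrC.
- exists (complex.Re `|a| * M + N) => x; rewrite !fctE.
  rewrite (le_trans (ler_rnormD _ _))// mulrDl lerD// rnormZ -mulrA.
  by rewrite ler_wpM2l// Re_normC_ge0.
Qed.

HB.instance Definition _ := GRing.isSubmodClosed.Build R[i] (V -> V)
  bounded_linear bounded_linear_submod_closed.

Record bounded_op := BoundedOp {
  bounded_op_fun :> V -> V;
  _ : bounded_op_fun \in bounded_linear }.

HB.instance Definition _ := [isSub for bounded_op_fun].
HB.instance Definition _ := [Choice of bounded_op by <:].
HB.instance Definition _ := [SubChoice_isSubLmodule of bounded_op by <:].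

Lemma bounded_op_linear (T : bounded_op) : linear T.
Proof. by case: T => T /= /asboolP[]. Qed.

Lemma bounded_op_bounded (T : bounded_op) :
  exists M : R, forall x, rnorm (T x) <= M * rnorm x.
Proof. by case: T => T /= /asboolP[]. Qed.

Lemma bounded_op0 (T : bounded_op) : T 0 = 0.
Proof.
have := bounded_op_linear T (- 1) 0 0.
by rewrite scaler0 addr0 scaleN1r addNr.
Qed.

Lemma bounded_opZ (T : bounded_op) (c : R[i]) x : T (c *: x) = c *: T x.
Proof. by have := bounded_op_linear T c x 0; rewrite !addr0 bounded_op0 addr0. Qed.

Lemma id_bounded_linear : idfun \in bounded_linear.
Proof. by apply/asboolP; split=> //; exists 1 => x; rewrite mul1r. Qed.

Definition id_op : bounded_op := BoundedOp id_bounded_linear.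

Definition opnorm (T : bounded_op) : R :=
  sup [set rnorm (T x) | x in [set x : V | rnorm x <= 1]].

Let opset_has_sup (T : bounded_op) :
  has_sup [set rnorm (T x) | x in [set x : V | rnorm x <= 1]].
Proof.
split; first by exists (rnorm (T 0)), 0 => //=; rewrite rnorm0.
have [M TM] := bounded_op_bounded T.
exists `|M| => _ [x /= x1 <-]; rewrite (le_trans (TM x))//.
rewrite (le_trans (ler_wpM2r (rnorm_ge0 x) (ler_norm M)))//.
by rewrite ler_piMr.
Qed.

Lemma opnorm_ge0 (T : bounded_op) : 0 <= opnorm T.
Proof.
apply: le_trans (rnorm_ge0 (T 0)) _.
by apply: ub_le_sup; [exact: (opset_has_sup T).2|exists 0 => //=; rewrite rnorm0].
Qed.

Lemma ler_opnorm (T : bounded_op) x : rnorm (T x) <= opnorm T * rnorm x.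
Proof.
have [x0|x0] := eqVneq (rnorm x) 0.
  by rewrite (rnorm_eq0 x0) bounded_op0 rnorm0 mulr0.
have xp : 0 < rnorm x by rewrite lt_neqAle eq_sym x0 rnorm_ge0.
have nx : complex.Re `|((rnorm x)^-1)%:C| = (rnorm x)^-1.
  by rewrite ger0_norm// lecR invr_ge0 ltW.
rewrite -ler_pdivrMr// mulrC -[X in X * _]nx -rnormZ -bounded_opZ.
apply: ub_le_sup; first exact: (opset_has_sup T).2.
by exists (((rnorm x)^-1)%:C *: x) => //=; rewrite rnormZ nx mulVf.
Qed.

Lemma opnorm_le (T : bounded_op) (M : R) : 0 <= M ->
  (forall x, rnorm (T x) <= M * rnorm x) -> opnorm T <= M.
Proof.
move=> M0 TM; apply: ge_sup; first exact: (opset_has_sup T).1.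
by move=> _ [x /= x1 <-]; rewrite (le_trans (TM x))// ler_piMr.
Qed.

Let normB (T : bounded_op) : R[i] := (opnorm T)%:C.

Let ler_normBD S T : normB (S + T) <= normB S + normB T.
Proof.
rewrite /normB -rmorphD/= lecR opnorm_le ?addr_ge0 ?opnorm_ge0// => x.
by rewrite (le_trans (ler_rnormD _ _))// mulrDl lerD// ler_opnorm.
Qed.

Let opnormZ_le (a : R[i]) T : opnorm (a *: T) <= complex.Re `|a| * opnorm T.
Proof.
have a0 := Re_normC_ge0 a.
rewrite opnorm_le ?mulr_ge0 ?opnorm_ge0// => x.
by rewrite rnormZ -mulrA ler_wpM2l// ler_opnorm.
Qed.

Let normBZ (a : R[i]) T : normB (a *: T) = `|a| * normB T.
Proof.
have aE := @Re_normC R.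
suff opnormZ : opnorm (a *: T) = complex.Re `|a| * opnorm T.
  by rewrite /normB opnormZ -aE rmorphM.
have [->|a0] := eqVneq a 0.
  apply/le_anti/andP; split; first exact: opnormZ_le.
  have -> : complex.Re `|0 : R[i]| = 0.
    by apply: (@complexI R); rewrite aE (@normr0 _ R[i]^o).
  by rewrite mul0r opnorm_ge0.
apply/le_anti/andP; split; first exact: opnormZ_le.
have ap : 0 < complex.Re `|a| by rewrite -ltcR aE normr_gt0.
rewrite -ler_pdivlMl//.
have := opnormZ_le a^-1 (a *: T); rewrite scalerA mulVf// scale1r.
suff -> : complex.Re `|a^-1| = (complex.Re `|a|)^-1 by [].
by apply: (@complexI R); rewrite fmorphV /= !aE normfV.
Qed.

Let normB_eq0 T : normB T = 0 -> T = 0.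
Proof.
move=> /(@complexI R) T0; apply/val_inj/funext => x /=.
by apply/rnorm_eq0/le_anti; rewrite rnorm_ge0 andbT -(mul0r (rnorm x)) -T0 ler_opnorm.
Qed.

(* B(V) is topologized by the operator norm. *)
HB.instance Definition _ :=
  Lmodule_isNormed.Build R[i] bounded_op ler_normBD normBZ normB_eq0.

Lemma norm_opnorm (T : bounded_op) : `|T| = (opnorm T)%:C.
Proof. by []. Qed.

End BoundedOperators.

Arguments id_op {R V}.

Definition unit_disc (R : realType) : set R[i] := [set z | `|z| < 1].
Arguments unit_disc : clear implicits.

Section OperatorValuedFunctions.
Variables (R : realType) (H : normedModType R[i]).
Implicit Types (f : R[i] -> bounded_op H) (A : nat -> bounded_op H).

Definition holomorphic_on_disc f : Prop :=
  forall z, unit_disc R z -> derivable (f : R[i]^o -> bounded_op H) z 1.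

Definition power_series_on_disc f A : Prop :=
  forall z, unit_disc R z -> [series z ^+ k *: A k]_k @ \oo --> f z.

(* The series have nonnegative terms, so their sums exist in \bar R. *)
Definition bohr_sum f A (r : R) : \bar R :=
  (\sum_(0 <= k <oo) (opnorm (A k) * r ^+ k)%:E
   + ((1 + opnorm (f 0))^-1 + r / (1 - r))%:E
     * \sum_(1 <= k <oo) (opnorm (A k) ^+ 2 * r ^+ (2 * k))%:E)%E.

End OperatorValuedFunctions.

(* Main.v *)
(** The coefficients satisfy [||A_k|| <= 1 - |a_0|^2] for k >= 1.  Indeed, multiplying
    f by [x + z^k y] and comparing L^2 norms on circles (Bessel) gives
    [||a_0 x||^2 + ||A_k x + a_0 y||^2 <= ||x||^2 + ||y||^2], and the choice
    [y = conj a_0 / (1 - |a_0|^2) A_k x] yields the bound.  The L^2 norms are averages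
    over roots of unity, which are exact for partial sums of the series of f; the
    tails are uniformly small on circles of radius < 1.  With a = |a_0| and r <= 1/3,
    summing the geometric majorants reduces the inequality to
    [0 <= (1 - a)^3 (5 + a) / 16].  For r > 1/3, the function (a - z) / (1 - a z) I with
    a close to 1 already has [sum_k ||A_k|| r^k > 1]. *)

Require Import Defs.
From mathcomp Require Import all_boot all_order all_algebra complex cyclotomic cyclic.
From mathcomp Require Import ring lra.
From mathcomp Require Import all_classical all_reals all_analysis.

Import Order.TTheory GRing.Theory Num.Theory.
Import numFieldNormedType.Exports.

Local Open Scope classical_set_scope.
Local Open Scope ring_scope.

(** * Roots of unity and the discrete Parseval identity *)

Section RootsOfUnity.
Variable C : numClosedFieldType.

(** In characteristic 0 the polynomial ['X^n - 1] is separable, so its linear factorization yields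
    [n] distinct [n]-th roots of unity, and among that many roots one is primitive. *)
Lemma exists_primitive_root n : (0 < n)%N -> exists w : C, n.-primitive_root w.
Proof.
move=> n0; have [r] := closed_field_poly_normal ('X^n - 1 : {poly C}).
rewrite (monicP _) ?monicXnsubC// scale1r => rE.
have rn1 : all n.-unity_root r by apply/allP => z; rewrite -root_prod_XsubC -rE.
have szr : (n < (size r).+1)%N.
  by rewrite -(size_prod_XsubC r id) -rE size_XnsubC.
have [|w _ wn] := hasP (has_prim_root n0 rn1 _ szr); last by exists w.
by rewrite -separable.separable_prod_XsubC -rE separable_Xn_sub_1// pnatr_eq0 -lt0n.
Qed.

Lemma norm_unity_root n (w : C) : (0 < n)%N -> w ^+ n = 1 -> `|w| = 1.
Proof.
move=> n0 wn; apply/eqP; rewrite -(@pexpr_eq1 _ _ n)//.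
by rewrite -normrX wn normr1.
Qed.

(** Since [|w| = 1], conjugates are inverses and the sum is geometric with ratio [q = w ^ (i - j)].
    As [i] and [j] are below [n], [q = 1] only for [i = j]; otherwise [q ^+ n = 1] makes [(q - 1)]
    times the sum vanish. *)
Lemma sum_primitive_root n (w : C) (i j : 'I_n) : n.-primitive_root w ->
  \sum_(l < n) (w ^+ l) ^+ i * ((w ^+ l) ^+ j)^* = n%:R *+ (i == j).
Proof.
move=> wn; have n0 := prim_order_gt0 wn.
have w1 := norm_unity_root _ _ n0 (prim_expr_order wn).
have w0 : w != 0 by rewrite -normr_eq0 w1 oner_eq0.
pose q := w ^+ i / w ^+ j.
have qE (l : 'I_n) : (w ^+ l) ^+ i * ((w ^+ l) ^+ j)^* = q ^+ l.
  rewrite -exprM -exprM exprMn exprVn -!exprM mulnC [(l * j)%N]mulnC.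
  by congr (_ * _); rewrite [RHS]invC_norm normrX w1 !expr1n invr1 mul1r.
under eq_bigr do rewrite qE.
have [ij|ij] := eqVneq i j.
  rewrite /q ij divff ?expf_neq0//; under eq_bigr do rewrite expr1n.
  by rewrite sumr_const card_ord.
have q1 : q - 1 != 0.
  rewrite subr_eq0; apply: contra ij => /eqP qe.
  have := eq_prim_root_expr wn i j.
  rewrite (_ : w ^+ i = w ^+ j); last by rewrite -[RHS]mul1r -qe divfK ?expf_neq0.
  by rewrite eqxx !modn_small// => /esym.
rewrite mulr0n; apply: (mulfI q1); rewrite mulr0 -subrX1.
rewrite /q exprMn exprVn -!exprM ![(_ * n)%N]mulnC !exprM.
by rewrite (prim_expr_order wn) !expr1n invr1 mulr1 subrr.
Qed.

(** Sesquilinear expansion followed by orthogonality of the characters. The degree below [n] ensures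
    that no two exponents agree modulo [n]. *)
Lemma discrete_parseval (U : lmodType C) (dot : {dot U for @Num.conj C})
    n (w : C) (g : 'I_n -> U) : n.-primitive_root w ->
  let G l := \sum_(i < n) (w ^+ l) ^+ i *: g i in
  \sum_(l < n) dot (G l) (G l) = n%:R * \sum_(i < n) dot (g i) (g i).
Proof.
move=> wn G.
transitivity (\sum_(l < n) \sum_(i < n) \sum_(j < n)
    (w ^+ l) ^+ i * ((w ^+ l) ^+ j)^* * dot (g i) (g j)).
  apply: eq_bigr => l _; rewrite linear_sumlz; apply: eq_bigr => i _.
  rewrite linear_sumr; apply: eq_bigr => j _.
  by rewrite linearZl_LR linearZr_LR/= mulrA.
rewrite exchange_big mulr_sumr; apply: eq_bigr => i _.
rewrite exchange_big (bigD1 i)//= -mulr_suml sum_primitive_root// eqxx mulr1n.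
rewrite big1 ?addr0// => j ji.
by rewrite -mulr_suml sum_primitive_root// eq_sym (negbTE ji) mulr0n mul0r.
Qed.

End RootsOfUnity.

(** * Coefficient estimates for operator polynomials bounded on the unit circle *)

Section OperatorPolynomials.
Variables (R : realType) (H : normedModType R[i]) (dot : {dot H for @Num.conj R[i]}).
Hypothesis dot_norm : forall x : H, `|x| ^+ 2 = dot x x.

Lemma bounded_opD (T : bounded_op H) x y : T (x + y) = T x + T y.
Proof. by have := bounded_op_linear T 1 x y; rewrite !scale1r. Qed.

Lemma bounded_op_sumE (I : Type) (s : seq I) (P : pred I) (T : I -> bounded_op H) x :
  (\sum_(i <- s | P i) T i) x = \sum_(i <- s | P i) T i x.
Proof. by elim/big_rec2: _ => // i y S _ <-. Qed.

Lemma norm_parseval n (w : R[i]) (g : nat -> H) : n.-primitive_root w ->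
  \sum_(l < n) `|\sum_(i < n) (w ^+ l) ^+ i *: g i| ^+ 2 =
  n%:R * \sum_(i < n) `|g i| ^+ 2.
Proof.
move=> wn; under eq_bigr do rewrite dot_norm.
rewrite (@discrete_parseval _ _ dot _ _ (fun i : 'I_n => g i) wn).
by congr (_ * _); apply: eq_bigr => i _; rewrite dot_norm.
Qed.

(* The operator matrix [[B_0, 0], [B_k, B_0]] compresses the multiplication by
   the polynomial to two coefficients, hence its norm is at most M. *)
Lemma norm_coef_pair (B : nat -> bounded_op H) N k (M : R[i]) (x y : H) :
  (0 < k < N)%N -> 0 <= M ->
  (forall w : R[i], `|w| = 1 -> forall v, `|\sum_(n < N) w ^+ n *: B n v| <= M * `|v|) ->
  `|B 0 x| ^+ 2 + `|B k x + B 0 y| ^+ 2 <= M ^+ 2 * (`|x| ^+ 2 + `|y| ^+ 2).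
Proof.
(* The product of a polynomial of degree below [N] with [x + z^k y] has degree below [N + k], so
   averaging over [L] roots of unity is exact for it. *)
move=> /andP[k0 kN] M0 BM; pose L := (N + k)%N.
have L0 : (0 < L)%N by rewrite addn_gt0 k0 orbT.
have kL : (k < L)%N by rewrite ltn_addr.
have [w wL] := @exists_primitive_root R[i] L L0.
have w1 l : `|w ^+ l| = 1.
  by rewrite normrX (norm_unity_root _ _ _ L0 (prim_expr_order wL)) expr1n.
(* [h] lists the coefficients of [x + z^k y], and [g] those of its image under the polynomial with
   coefficients [B n]. *)
pose h n := if n == 0%N then x else if n == k then y else 0.
pose g n := (if (n < N)%N then B n x else 0) +
            (if (k <= n)%N then B (n - k)%N y else 0).
have hE (c : R[i]) : \sum_(n < L) c ^+ n *: h n = x + c ^+ k *: y.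
  rewrite (bigD1 (Ordinal L0))//= (bigD1 (Ordinal kL))/=; last first.
    by rewrite -val_eqE/= -lt0n.
  rewrite /h/= eqxx [k == 0%N]gtn_eqF// expr0 scale1r big1 ?addr0// => i.
  by rewrite -!val_eqE/= => /andP[/negbTE -> /negbTE ->]; rewrite scaler0.
have gE (c : R[i]) : \sum_(n < L) c ^+ n *: g n =
    \sum_(n < N) c ^+ n *: B n (x + c ^+ k *: y).
  transitivity (\sum_(n < N) c ^+ n *: B n x + \sum_(n < N) c ^+ (n + k) *: B n y).
    under eq_bigr do rewrite scalerDr.
    rewrite big_split/=; congr (_ + _).
      rewrite big_split_ord/= [X in _ + X]big1 ?addr0; last first.
        by move=> i _; rewrite ltnNge leq_addr scaler0.
      by apply: eq_bigr => i _; rewrite ltn_ord.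
    rewrite -(big_mkord xpredT
      (fun n => c ^+ n *: (if (k <= n)%N then B (n - k)%N y else 0))).
    rewrite (big_cat_nat (n := k)) ?(ltnW kL)//= big_nat big1 ?add0r; last first.
      by move=> i /andP[_ ik]; rewrite leqNgt ik scaler0.
    rewrite -{1}[k]add0n big_addn addnK big_mkord; apply: eq_bigr => i _.
    by rewrite leq_addl addnK.
  rewrite -big_split/=; apply: eq_bigr => n _.
  by rewrite bounded_opD bounded_opZ scalerDr scalerA exprD.
have Lpos : (0 : R[i]) < L%:R by rewrite ltr0n.
rewrite -(ler_pM2l Lpos).
(* Bessel: only the coefficients [g 0 = B 0 x] and [g k = B k x + B 0 y] are kept. *)
apply: (@le_trans _ _ (L%:R * \sum_(n < L) `|g n| ^+ 2)).
  rewrite ler_pM2l// (bigD1 (Ordinal L0))//= (bigD1 (Ordinal kL))/=; last first.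
    by rewrite -val_eqE/= -lt0n.
  rewrite /g/= (leq_trans _ kN)// [(k <= 0)%N]leqNgt k0/= addr0 kN leqnn subnn.
  by rewrite addrA lerDl sumr_ge0// => i _; rewrite exprn_ge0.
rewrite -(norm_parseval _ _ _ wL).
(* The bound [M] is applied at each root of unity; Parseval for [h] then gives the right-hand
   side. *)
apply: (@le_trans _ _ (\sum_(l < L) M ^+ 2 *
    `|\sum_(n < L) (w ^+ l) ^+ n *: h n| ^+ 2)).
  apply: ler_sum => l _; rewrite gE hE -exprMn.
  by rewrite lerXn2r ?nnegrE ?mulr_ge0// BM.
rewrite -mulr_sumr (norm_parseval _ _ _ wL) mulrCA ler_pM2l// ler_wpM2l ?exprn_ge0//.
rewrite (bigD1 (Ordinal L0))//= (bigD1 (Ordinal kL))/=; last first.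
  by rewrite -val_eqE/= -lt0n.
rewrite /h/= eqxx [k == 0%N]gtn_eqF// big1 ?addr0// => i.
by rewrite -!val_eqE/= => /andP[/negbTE -> /negbTE ->]; rewrite normr0 expr0n.
Qed.

(** The pair inequality is used with [y = (b^* / D) *: B k x], where [D = M ^+ 2 - |b| ^+ 2]. For
    this [y] it becomes the square of the claim, divided by [D]. *)
Lemma norm_coef_le (B : nat -> bounded_op H) N k (M b : R[i]) (x : H) :
  (0 < k < N)%N -> `|b| < M -> (forall v, B 0 v = b *: v) ->
  (forall w : R[i], `|w| = 1 -> forall v, `|\sum_(n < N) w ^+ n *: B n v| <= M * `|v|) ->
  M * `|B k x| <= (M ^+ 2 - `|b| ^+ 2) * `|x|.
Proof.
move=> kN bM B0 BM; have M0 : 0 < M := le_lt_trans (normr_ge0 b) bM.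
pose D := M ^+ 2 - `|b| ^+ 2.
have D0 : 0 < D by rewrite subr_gt0 ltrXn2r ?nnegrE// ltW.
rewrite -/D -[_ <= _](@ler_pXn2r _ 2%N)// ?nnegrE ?mulr_ge0// ?(ltW D0)// ?(ltW M0)//.
have := norm_coef_pair B N k M x ((b^* / D) *: B k x) kN (ltW M0) BM.
(* This is [1 + |b| ^+ 2 / D = M ^+ 2 / D]. *)
have -> : B k x + B 0 ((b^* / D) *: B k x) = (M ^+ 2 / D) *: B k x.
  rewrite B0 scalerA -{1}[B k x]scale1r -scalerDl; congr (_ *: _).
  by rewrite mulrA -normCK /D; field; rewrite gt_eqF.
rewrite B0 !normrZ !normf_div norm_conjC (gtr0_norm D0) normrX (gtr0_norm M0).
set c := `|B k x|; set X := `|x| => cX.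
(* After multiplication by [D^-1], the difference of the two sides of the squared goal equals that
   of the pair inequality. *)
rewrite -subr_ge0 -(pmulr_lge0 _ (_ : 0 < D^-1)) ?invr_gt0//.
rewrite -subr_ge0 in cX; apply: le_trans cX _.
rewrite le_eqVlt; apply/orP; left; apply/eqP.
rewrite /D; field.
by rewrite gt_eqF.
Qed.

End OperatorPolynomials.

(** * Uniform smallness of power series tails on circles inside the disc *)

Section PowerSeriesTails.
Variables (R : realType) (V : normedModType R[i]).

Lemma rnormB (x y : V) : rnorm (x - y) = rnorm (y - x).
Proof. by rewrite /rnorm distrC. Qed.

Lemma ler_rnorm_sum (I : Type) (s : seq I) (P : pred I) (F : I -> V) :
  rnorm (\sum_(i <- s | P i) F i) <= \sum_(i <- s | P i) rnorm (F i).
Proof.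
elim/big_rec2: _ => [|i y x _ xy]; first by rewrite rnorm0.
by rewrite (le_trans (ler_rnormD _ _))// lerD2l.
Qed.

(** Convergence at the midpoint [s] of [rho] and 1 forces the terms there to tend to 0. Hence on the
    circle of radius [rho] the tails are dominated by a geometric series of ratio [q = rho / s],
    uniformly in [z]. *)
Lemma power_series_tail (A : nat -> V) (f : R[i] -> V) (rho e : R) :
  (forall z, unit_disc R z -> [series z ^+ k *: A k]_k @ \oo --> f z) ->
  0 < rho < 1 -> 0 < e ->
  \forall N \near \oo, forall z : R[i], `|z| = (rho%:C)%C ->
    rnorm (f z - \sum_(n < N) z ^+ n *: A n) <= e.
Proof.
move=> fA /andP[rho0 rho1] e0; pose s := (1 + rho) / 2; pose q := rho / s.
have s0 : 0 < s by rewrite /s; lra.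
have s1 : s < 1 by rewrite /s; lra.
have q0 : 0 < q by rewrite divr_gt0.
have q1 : q < 1 by rewrite /q ltr_pdivrMr// mul1r /s; lra.
have nC (t : R) : 0 < t -> `|(t%:C)%C| = (t%:C)%C.
  by move=> t0; rewrite gtr0_norm// ltcR.
have : [series (s%:C)%C ^+ k *: A k]_k @ \oo --> f (s%:C)%C.
  by apply: fA; rewrite /unit_disc/= nC// ltcR.
move/cvgP/cvg_series_cvg_0/cvgrPdist_lt/(_ 1 ltr01) => Abound.
have /cvgrPdist_lt/(_ (e / 2 * (1 - q))) qN : GRing.exp q n @[n --> \oo] --> 0.
  by apply: cvg_expr; rewrite gtr0_norm.
(* With this threshold the geometric tail [q ^+ N / (1 - q)] is at most [e / 2]. *)
have /qN{}qN : 0 < e / 2 * (1 - q) by rewrite mulr_gt0 ?divr_gt0// subr_gt0.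
case: Abound => n0 _ Abound.
have Aq n : (n0 <= n)%N -> rnorm (A n) * rho ^+ n <= q ^+ n.
  move=> /Abound/=; rewrite sub0r normrN normrZ normrX nC// -rnormE -rmorphXn -rmorphM/=.
  rewrite ltcR => As; rewrite /q exprMn mulrC ler_pM2l ?exprn_gt0// exprVn.
  by rewrite -[leRHS]mul1r ler_pdivlMr ?exprn_gt0// mulrC ltW.
near=> N => z zrho.
have Nn0 : (n0 <= N)%N by near: N; exists n0.
have qNe : q ^+ N < e / 2 * (1 - q).
  have : `|0 - q ^+ N| < e / 2 * (1 - q) by near: N; exact: qN.
  by rewrite sub0r normrN gtr0_norm// exprn_gt0.
(* The index [m0] depends on [z]. This is harmless, because the bound on the block from [N] to
   [N + m0] does not involve [m0]. *)
have /fA/cvgrPdist_lt/(_ ((e / 2)%:C)%C) : unit_disc R z.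
  by rewrite /unit_disc/= zrho ltcR.
rewrite ltcR divr_gt0// => /(_ isT) [m0 _ /(_ (N + m0)%N (leq_addl _ _))/= fz].
rewrite -(subrKA (\sum_(0 <= k < N + m0) z ^+ k *: A k)).
rewrite (le_trans (ler_rnormD _ _))// [leRHS]splitr lerD//.
  by move: fz; rewrite -rnormE ltcR => /ltW.
rewrite -(big_mkord xpredT (fun k => z ^+ k *: A k)) (big_cat_nat (n := N)) ?leq_addr//=.
rewrite addrAC subrr add0r (le_trans (ler_rnorm_sum _ _ _ _))//.
apply: (@le_trans _ _ (\sum_(N <= k < N + m0) q ^+ k)).
  apply: ler_sum_nat => k /andP[Nk _].
  apply: le_trans (Aq k (leq_trans Nn0 Nk)).
  by rewrite -lecR rnormE normrZ normrX zrho -rnormE -rmorphXn -rmorphM/= mulrC.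
rewrite geometric_partial_tail (le_trans (geometric_le_lim _ _ _ _))// ?exprn_ge0 ?(ltW q0)//.
  by rewrite gtr0_norm.
by rewrite ler_pdivrMr ?subr_gt0// ltW.
Unshelve. all: by end_near. Qed.

End PowerSeriesTails.

(** * The coefficient bound for operator-valued functions *)

Section CoefficientBound.
Variables (R : realType) (H : normedModType R[i]) (dot : {dot H for @Num.conj R[i]}).
Hypothesis dot_norm : forall x : H, `|x| ^+ 2 = dot x x.

(** For [rho < 1], long partial sums on the circle of radius [rho] have norm at most [1 + d], so the
    polynomial estimate applies to [B n = rho^n A_n]. Letting the error tend to 0, and then [rho] to
    1, gives the bound. *)
Lemma opnorm_coef_le (f : R[i] -> bounded_op H) (A : nat -> bounded_op H)
    (a0 : R[i]) (k : nat) :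
  power_series_on_disc f A -> A 0%N = a0 *: id_op -> `|a0| < 1 ->
  (forall z, unit_disc R z -> opnorm (f z) <= 1) -> (0 < k)%N ->
  opnorm (A k) <= 1 - complex.Re `|a0| ^+ 2.
Proof.
move=> fA A0 a01 f1 k0; set a := complex.Re `|a0|.
have a0E : `|a0| = (a%:C)%C by rewrite /a Re_normC.
have a1 : a < 1 by rewrite -ltcR -a0E.
have age0 : 0 <= a by exact: Re_normC_ge0.
have step rho : 0 < rho < 1 -> opnorm (A k) * rho ^+ k <= 1 - a ^+ 2.
  move=> /andP[rho0 rho1]; apply/ler_addgt0Pr => e e0.
  (* With [d <= 1] one has [2 * d + d ^+ 2 <= 3 * d <= e], which puts
     [((1 + d) ^+ 2 - a ^+ 2) / (1 + d)] below [1 - a ^+ 2 + e]. *)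
  pose d := Num.min 1 (e / 3).
  have d0 : 0 < d by rewrite lt_min ltr01 divr_gt0.
  have rho01 : 0 < rho < 1 by rewrite rho0.
  have [N0 _ tailN] := @power_series_tail _ _ _ _ _ _ fA rho01 d0.
  pose N := (N0 + k.+1)%N; have {tailN} tail := tailN N (leq_addr _ _).
  pose B n : bounded_op H := (rho%:C)%C ^+ n *: A n.
  have BM w : `|w| = 1 -> forall v,
      `|\sum_(n < N) w ^+ n *: B n v| <= ((1 + d)%:C)%C * `|v|.
    move=> w1 v; pose z : R[i] := w * (rho%:C)%C.
    have zrho : `|z| = (rho%:C)%C.
      by rewrite normrM w1 mul1r gtr0_norm// ltcR.
    have -> : \sum_(n < N) w ^+ n *: B n v = (\sum_(n < N) z ^+ n *: A n) v.
      rewrite bounded_op_sumE; apply: eq_bigr => n _.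
      by rewrite /B/= exprMn -scalerA.
    rewrite -!rnormE -rmorphM lecR.
    rewrite (le_trans (ler_opnorm _ _))// ler_wpM2r ?rnorm_ge0//.
    have /f1 fz1 : unit_disc R z by rewrite /unit_disc/= zrho ltcR.
    rewrite -[\sum_(n < N) _](subrK (f z)) [leRHS]addrC.
    have nE (T : bounded_op H) : opnorm T = rnorm T by [].
    rewrite nE (le_trans (ler_rnormD _ _))// lerD//.
    by rewrite rnormB tail.
  have B0 v : B 0%N v = a0 *: v by rewrite /B expr0 scale1r A0.
  have aM : `|a0| < ((1 + d)%:C)%C.
    by rewrite a0E ltcR (lt_trans a1)// ltrDl.
  have kN : (0 < k < N)%N by rewrite k0 ltn_addl.
  have Bk v : rnorm (B k v) <= (((1 + d) ^+ 2 - a ^+ 2) / (1 + d)) * rnorm v.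
    rewrite mulrAC ler_pdivlMr ?addr_gt0// mulrC.
    have := @norm_coef_le _ _ _ dot_norm B N k _ a0 v kN aM B0 BM.
    by rewrite a0E -!rmorphXn -rmorphB -!rnormE -!rmorphM lecR.
  have -> : opnorm (A k) * rho ^+ k = opnorm (B k).
    have nE (T : bounded_op H) : opnorm T = rnorm T by [].
    rewrite !nE /B rnormZ mulrC; congr (_ * _); apply: complexI.
    by rewrite Re_normC normrX rmorphXn gtr0_norm// ltcR.
  have d1 : d <= 1 by rewrite ge_min lexx.
  have d3 : d <= e / 3 by rewrite ge_min lexx orbT.
  have Ma : a ^+ 2 <= (1 + d) ^+ 2.
    by rewrite lerXn2r ?nnegrE ?addr_ge0// ltW//; lra.
  rewrite (le_trans (opnorm_le _ Bk))//.
    by rewrite divr_ge0 ?subr_ge0// addr_ge0// ltW.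
  rewrite ler_pdivrMr ?addr_gt0//; nra.
(* The factor [rho ^+ k] is removed by letting the radius tend to 1 from the left. *)
have rk : opnorm (A k) * t ^+ k @[t --> 1^'-] --> opnorm (A k) * 1 ^+ k.
  by apply: cvg_at_left_filter; apply: cvgMl_tmp; exact: exprn_continuous.
rewrite expr1n mulr1 in rk.
apply: (cvgr_to_le rk); near=> t; apply: step; apply/andP; split; near: t.
  exact: nbhs_left_gt.
exact: nbhs_left_lt.
Unshelve. all: by end_near. Qed.

End CoefficientBound.

(** * Geometric majorants and the inequality for [r <= 1/3] *)

Section BohrSum.
Variable R : realType.

Lemma sum_expr_le (x : R) n : 0 <= x < 1 -> \sum_(1 <= k < n) x ^+ k <= x / (1 - x).
Proof.
move=> /andP[x0 x1]; rewrite ler_pdivlMr ?subr_gt0//.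
case: n => [|n]; first by rewrite big_geq// mul0r.
have -> : (\sum_(1 <= k < n.+1) x ^+ k) * (1 - x) = x - x ^+ n.+1.
  elim: n => [|n IHn]; first by rewrite big_geq// mul0r expr1 subrr.
  by rewrite big_nat_recr//= mulrDl IHn !exprS; ring.
by rewrite lerBlDr lerDl exprn_ge0.
Qed.

Lemma nneseries_le (u : nat -> R) (m : nat) (b : R) : (forall k, 0 <= u k) ->
  (forall n, \sum_(m <= k < n) u k <= b) ->
  (\sum_(m <= k <oo) (u k)%:E <= b%:E)%E.
Proof.
move=> u0 ub; apply: lime_le.
  by apply: is_cvg_nneseries => n _ _; rewrite lee_fin.
by apply: nearW => n; rewrite sumEFin lee_fin.
Qed.

(** The expression increases with [r / (1 - r)] and with [r ^+ 2 / (1 - r ^+ 2)], which for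
    [r <= 1/3] are at most [1/2] and [1/8]. At these values it falls short of 1 by
    [(1 - a) ^+ 3 * (5 + a) / 16]. *)
Lemma bohr_majorant_le1 (a r : R) : 0 <= a <= 1 -> 0 <= r <= 3^-1 ->
  a + (1 - a ^+ 2) * (r / (1 - r)) +
  ((1 + a)^-1 + r / (1 - r)) * ((1 - a ^+ 2) ^+ 2 * (r ^+ 2 / (1 - r ^+ 2))) <= 1.
Proof.
move=> /andP[a0 a1] /andP[r0 r3].
have r1 : 0 < 1 - r by lra.
have rr : r ^+ 2 <= 9^-1 by nra.
have rr1 : 0 < 1 - r ^+ 2 by lra.
have u2 : r / (1 - r) <= 2^-1 by rewrite ler_pdivrMr//; lra.
have u0 : 0 <= r / (1 - r) by rewrite divr_ge0// ltW.
have v8 : r ^+ 2 / (1 - r ^+ 2) <= 8^-1 by rewrite ler_pdivrMr//; lra.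
have v0 : 0 <= r ^+ 2 / (1 - r ^+ 2) by rewrite divr_ge0 ?exprn_ge0// ltW.
have b0 : 0 <= 1 - a ^+ 2 by nra.
have ia0 : 0 <= (1 + a)^-1 by rewrite invr_ge0; lra.
apply: (@le_trans _ _ (a + (1 - a ^+ 2) * 2^-1 +
    ((1 + a)^-1 + 2^-1) * ((1 - a ^+ 2) ^+ 2 * 8^-1))).
  rewrite !lerD//; first by rewrite ler_wpM2l.
  apply: ler_pM; [exact: addr_ge0|by rewrite mulr_ge0// exprn_ge0|exact: lerD|].
  by rewrite ler_wpM2l ?exprn_ge0.
rewrite -subr_ge0; set t := (X in 0 <= X).
have -> : t = (1 - a) ^+ 3 * (5 + a) / 16
  by rewrite /t; field; lra.
by rewrite !mulr_ge0// ?exprn_ge0//; lra.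
Qed.

(** The coefficient bound majorizes the two series by geometric series of ratios [r] and [r ^+ 2];
    the term [k = 0] of the first contributes [a]. *)
Lemma bohr_sum_le1 (H : normedModType R[i]) (f : R[i] -> bounded_op H)
    (A : nat -> bounded_op H) (r : R) :
  opnorm (f 0) = opnorm (A 0%N) -> opnorm (A 0%N) <= 1 ->
  (forall k, (0 < k)%N -> opnorm (A k) <= 1 - opnorm (A 0%N) ^+ 2) ->
  0 <= r <= 3^-1 -> (bohr_sum f A r <= 1)%E.
Proof.
move=> fA a1 Ak r03; have /andP[r0 r3] := r03; set a := opnorm (A 0%N).
have a0 : 0 <= a := opnorm_ge0 _.
have r1 : 0 <= r < 1 by apply/andP; split=> //; lra.
have rr1 : 0 <= r ^+ 2 < 1 by apply/andP; split; nra.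
have b0 : 0 <= 1 - a ^+ 2 by rewrite subr_ge0 expr_le1.
apply: (@le_trans _ _ ((a + (1 - a ^+ 2) * (r / (1 - r)) +
  ((1 + a)^-1 + r / (1 - r)) * ((1 - a ^+ 2) ^+ 2 * (r ^+ 2 / (1 - r ^+ 2))))%:E)).
  rewrite /bohr_sum fA -/a [X in (_ <= X)%E]EFinD; apply: leeD.
    apply: nneseries_le => [k|n]; first by rewrite mulr_ge0 ?opnorm_ge0 ?exprn_ge0.
    (* The empty partial sum is treated apart, since it has no term [k = 0] to split off. *)
    case: n => [|n].
      by rewrite big_geq// addr_ge0// mulr_ge0// divr_ge0//; lra.
    rewrite big_nat_recl// expr0 mulr1 lerD2l.
    apply: (@le_trans _ _ (\sum_(1 <= k < n.+1) (1 - a ^+ 2) * r ^+ k)).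
      rewrite big_add1/=; apply: ler_sum_nat => k _.
      by rewrite ler_wpM2r ?exprn_ge0// Ak.
    by rewrite -mulr_sumr ler_wpM2l// sum_expr_le.
  rewrite EFinM lee_wpmul2l//.
    by rewrite lee_fin addr_ge0// ?invr_ge0 ?addr_ge0// divr_ge0//; lra.
  apply: nneseries_le => [k|n]; first by rewrite mulr_ge0 ?exprn_ge0 ?opnorm_ge0.
  apply: (@le_trans _ _ (\sum_(1 <= k < n) (1 - a ^+ 2) ^+ 2 * (r ^+ 2) ^+ k)).
    apply: ler_sum_nat => k /andP[k1 _].
    rewrite -exprM ler_wpM2r ?exprn_ge0// lerXn2r ?nnegrE ?opnorm_ge0//.
    exact: Ak.
  by rewrite -mulr_sumr ler_wpM2l ?exprn_ge0// sum_expr_le.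
by rewrite lee_fin; apply: bohr_majorant_le1 => //; rewrite a0.
Qed.

End BohrSum.

(** * Scalar operators, the zero space, and values at the origin *)

Section ScalarOperators.
Variables (R : realType) (H : normedModType R[i]).

Lemma opnorm_scalar_le (c : R[i]) : opnorm (c *: id_op : bounded_op H) <= complex.Re `|c|.
Proof. by apply: opnorm_le => [|x]; rewrite ?Re_normC_ge0// rnormZ. Qed.

(** A nonzero vector is required: on the zero space the identity has norm 0. *)
Lemma opnorm_scalar (c : R[i]) : (exists x : H, x != 0) ->
  opnorm (c *: id_op : bounded_op H) = complex.Re `|c|.
Proof.
move=> [x x0]; apply/le_anti; rewrite opnorm_scalar_le/=.
have xp : 0 < rnorm x by rewrite -ltcR rnormE normr_gt0.
by rewrite -(ler_pM2r xp) -rnormZ; exact: (ler_opnorm (c *: id_op)).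
Qed.

Lemma opnorm_trivial (T : bounded_op H) : ~ (exists x : H, x != 0) -> opnorm T = 0.
Proof.
move=> H0; apply/le_anti; rewrite opnorm_ge0 andbT; apply: opnorm_le => // x.
suff -> : x = 0 by rewrite bounded_op0 rnorm0 mulr0.
by apply/eqP; apply: contra_notT H0 => x0; exists x.
Qed.

Lemma power_series_at0 (f : R[i] -> bounded_op H) (A : nat -> bounded_op H) :
  power_series_on_disc f A -> f 0 = A 0%N.
Proof.
move=> /(_ 0); rewrite /unit_disc/= normr0 => /(_ ltr01) f0.
suff A0 : [series (0 : R[i]) ^+ k *: A k]_k @ \oo --> A 0%N.
  exact: (cvg_unique (@norm_hausdorff _ _) f0 A0).
(* At [z = 0] the partial sums equal [A 0] from index 1 on; the one of index 0 is empty. *)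
apply: cvg_near_cst; exists 1%N => // -[//|n] _ /=.
rewrite /series/= big_nat_recl// expr0 scale1r big1 ?addr0// => k _.
by rewrite expr0n scale0r.
Qed.

(** Passing to norms reduces the claim to powers of a real number; a positive [e] in [R[i]] is
    itself real. *)
Lemma cvg_expr_complex (x : R[i]) : `|x| < 1 -> x ^+ n @[n --> \oo] --> (0 : R[i]^o).
Proof.
move=> x1; pose t : R := complex.Re `|x|.
have xE : `|x| = (t%:C)%C by rewrite Re_normC.
have t0 : 0 <= t := Re_normC_ge0 x.
have t1 : `|t| < 1 by rewrite ger0_norm// -ltcR -xE.
apply/(@cvgrPdist_lt _ R[i]^o) => e e0.
have eE : e = ((complex.Re e)%:C)%C by rewrite RRe_real// gtr0_real.
have /cvgrPdist_lt/(_ (complex.Re e)) := @cvg_expr R t t1.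
rewrite -ltcR -eE => /(_ e0); apply: filterS => n.
by rewrite !sub0r !normrN ger0_norm ?exprn_ge0// normrX xE -rmorphXn eE ltcR.
Qed.

End ScalarOperators.

(** * Disc automorphisms as counterexamples for [r > 1/3] *)

Section Sharpness.
Variables (R : realType) (H : normedModType R[i]) (a : R).
Hypotheses (a0 : 0 < a) (a1 : a < 1).
Local Notation aC := ((a%:C)%C : R[i]).

(** The automorphism of the disc that exchanges 0 and [a]. *)
Definition blaschke (z : R[i]) : R[i] := (aC - z) / (1 - aC * z).

(** Taylor coefficients at 0, read off from [a - z = a (1 - a z) - (1 - a^2) z]. *)
Definition blaschke_coef (n : nat) : R[i] :=
  if n is m.+1 then - (1 - aC ^+ 2) * aC ^+ m else aC.

Lemma norm_mul_lt1 (z : R[i]) : `|z| < 1 -> `|aC * z| < 1.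
Proof.
have aC0 : 0 < aC by rewrite ltcR.
have aC1 : aC < 1 by rewrite ltcR.
by move=> z1; rewrite normrM (gtr0_norm aC0) mulr_ilt1// ltW.
Qed.

Lemma blaschke_denom_neq0 (z : R[i]) : `|z| < 1 -> 1 - aC * z != 0.
Proof.
move=> /norm_mul_lt1; apply: contraTneq => /eqP; rewrite subr_eq0 => /eqP <-.
by rewrite normr1 ltxx.
Qed.

Lemma norm_blaschke_le1 (z : R[i]) : `|z| < 1 -> `|blaschke z| <= 1.
Proof.
move=> z1; have d0 := blaschke_denom_neq0 _ z1.
rewrite normf_div ler_pdivrMr ?normr_gt0// mul1r.
rewrite -[_ <= _](@ler_pXn2r _ 2%N)// ?nnegrE// !normCK.
rewrite !rmorphB !rmorphM/= rmorph1 conj_Creal; last by rewrite gtr0_real// ltcR.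
(* The identity [|1 - a z|^2 - |a - z|^2 = (1 - a^2) (1 - |z|^2)]. *)
rewrite -subr_ge0 (_ : _ - _ = (1 - aC ^+ 2) * (1 - z * z^*)); last by ring.
have aC0 : 0 <= aC by rewrite lecR ltW.
have aC1 : aC <= 1 by rewrite lecR ltW.
by rewrite -normCK mulr_ge0// subr_ge0 expr_le1// ltW.
Qed.

Lemma derivable_blaschke (z : R[i]) : `|z| < 1 ->
  derivable (blaschke : R[i]^o -> R[i]^o) z 1.
Proof.
move=> z1; apply: derivableM; first exact: derivableB.
apply: derivableV; first exact: blaschke_denom_neq0.
by apply: derivableB => //; apply: derivableM.
Qed.

Lemma blaschke_series (z : R[i]) : `|z| < 1 ->
  \sum_(0 <= k < n) z ^+ k * blaschke_coef k @[n --> \oo] --> (blaschke z : R[i]^o).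
Proof.
move=> z1; rewrite -(@cvg_shiftS R[i]^o).
(* Closed form of the partial sums: their distance from the limit is a constant multiple of
   [(a z)^n]. The shift by one ensures that the constant coefficient is always present. *)
have -> : [sequence \sum_(0 <= k < n.+1) z ^+ k * blaschke_coef k]_n =
    (fun n => blaschke z - - (1 - aC ^+ 2) * z / (1 - aC * z) * (aC * z) ^+ n).
  apply/funext => n /=; elim: n => [|n IHn].
    rewrite big_nat1 /blaschke !expr0 /=; field; exact: blaschke_denom_neq0.
  rewrite big_nat_recr//= IHn /blaschke exprMn !exprS exprMn; field.
  exact: blaschke_denom_neq0.
set K := - (1 - aC ^+ 2) * z / (1 - aC * z).
suff : blaschke z - K * (aC * z) ^+ n @[n --> \oo] --> (blaschke z - K * 0 : R[i]^o).
  by rewrite mulr0 subr0.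
apply: (@cvgB _ R[i]^o); first exact: (@cvg_cst R[i]^o).
by apply: cvgMl_tmp; exact/cvg_expr_complex/norm_mul_lt1.
Qed.

(** The difference quotient is the scalar one times the identity, and scaling a fixed operator is
    continuous. *)
Lemma holomorphic_blaschke :
  holomorphic_on_disc (fun z => blaschke z *: id_op : bounded_op H).
Proof.
move=> z z1; have /cvg_ex[l dl] := derivable_blaschke _ z1.
apply/cvg_ex; exists (l *: id_op).
have -> : (fun h : R[i] => h^-1 *: (((fun z => blaschke z *: id_op : bounded_op H)
    \o shift z) (h *: (1 : R[i]^o)) - blaschke z *: id_op)) =
  (fun h : R[i] => (h^-1 *: ((blaschke \o shift z) (h *: (1 : R[i]^o)) - blaschke z))
     *: id_op).
  by apply/funext => h /=; rewrite -scalerBl scalerA.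
exact: cvgZr_tmp.
Qed.

Lemma power_series_blaschke :
  power_series_on_disc (fun z => blaschke z *: id_op : bounded_op H)
    (fun n => blaschke_coef n *: id_op).
Proof.
move=> z z1; have -> : [series z ^+ k *: (blaschke_coef k *: id_op : bounded_op H)]_k =
    (fun n => (\sum_(0 <= k < n) z ^+ k * blaschke_coef k) *: id_op).
  by apply/funext => n; rewrite /series/= scaler_suml; under eq_bigr do rewrite scalerA.
by apply: cvgZr_tmp; exact: blaschke_series.
Qed.

(** The first series alone sums to [a + (1 - a^2) r / (1 - a r)], which exceeds 1 by
    [(1 - a) (r (1 + 2 a) - 1) / (1 - a r)]; the remaining term is nonnegative. *)
Lemma bohr_sum_blaschke_gt1 (r : R) : (exists x : H, x != 0) ->
  0 < r < 1 -> 1 < r * (1 + 2 * a) ->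
  ~ (bohr_sum (fun z => blaschke z *: id_op : bounded_op H)
       (fun n => blaschke_coef n *: id_op) r <= 1)%E.
Proof.
move=> Hn0 /andP[r0 r1] ra; apply/negP; rewrite -ltNge.
have ar1 : a * r < 1 by rewrite mulr_ilt1// ltW.
have b0 : 0 <= 1 - a ^+ 2 by rewrite subr_ge0 expr_le1// ltW.
apply: (@lt_le_trans _ _ (a + (1 - a ^+ 2) * (r / (1 - a * r)))%:E).
  rewrite lte_fin -subr_gt0 (_ : _ - _ = (1 - a) * (r * (1 + 2 * a) - 1) / (1 - a * r)).
    by rewrite divr_gt0 ?mulr_gt0 ?subr_gt0.
  by field; rewrite gt_eqF ?subr_gt0.
rewrite /bohr_sum -[leLHS]adde0 leeD//; last first.
  rewrite mule_ge0// ?lee_fin.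
    by rewrite addr_ge0// ?invr_ge0 ?addr_ge0 ?opnorm_ge0// divr_ge0//; lra.
  by apply: nneseries_ge0 => k _ _; rewrite lee_fin mulr_ge0 ?exprn_ge0 ?opnorm_ge0// ltW.
have nC (t : R) : 0 <= t -> complex.Re `|(t%:C)%C| = t.
  by move=> t0; rewrite ger0_norm// lecR.
have cE k : opnorm (blaschke_coef k *: id_op : bounded_op H) =
    if k is m.+1 then (1 - a ^+ 2) * a ^+ m else a.
  rewrite opnorm_scalar//; case: k => [|m]; rewrite /blaschke_coef; first by rewrite nC// ltW.
  have -> : - (1 - aC ^+ 2) * aC ^+ m = - (((1 - a ^+ 2) * a ^+ m)%:C)%C.
    by rewrite rmorphM rmorphB rmorph1 !rmorphXn mulNr.
  rewrite normrN nC//.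
  by rewrite mulr_ge0// exprn_ge0// ltW.
rewrite (_ : (\sum_(0 <= k <oo) _)%E = (a + (1 - a ^+ 2) * (r / (1 - a * r)))%:E)//.
apply: cvg_lim => //; rewrite -cvg_shiftS.
rewrite (_ : [sequence _]_n =
    EFin \o (fun n => a + series (geometric ((1 - a ^+ 2) * r) (a * r)) n)).
  apply: cvg_EFin; first exact: nearW.
  apply: cvgD; first exact: cvg_cst.
  rewrite mulrA; apply: cvg_geometric_series.
  by rewrite gtr0_norm// mulr_gt0.
apply/funext => n /=; rewrite sumEFin big_nat_recl// cE expr0 mulr1; congr (_ + _)%:E.
by apply: eq_bigr => k _; rewrite cE /geometric/= exprMn [r ^+ k.+1]exprS; ring.
Qed.

End Sharpness.

(** * The Bohr inequality up to [1/3] and its failure beyond *)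

Theorem lemma3p12 (R : realType) (H : completeNormedModType R[i])
    (dot : {dot H for @Num.conj R[i]})
    (dot_norm : forall x : H, `|x| ^+ 2 = dot x x) :
  (forall (f : R[i] -> bounded_op H) (A : nat -> bounded_op H) (a0 : R[i]),
      holomorphic_on_disc f ->
      [bounded f z | z in unit_disc R] ->
      power_series_on_disc f A ->
      A 0%N = a0 *: id_op ->
      `|a0| < 1 ->
      (forall z, unit_disc R z -> opnorm (f z) <= 1) ->
      forall r : R, 0 <= r <= 3^-1 -> (bohr_sum f A r <= 1)%E)
  /\
  ((exists x : H, x != 0) ->
   forall r : R, 3^-1 < r < 1 ->
   exists (f : R[i] -> bounded_op H) (A : nat -> bounded_op H) (a0 : R[i]),
     [/\ holomorphic_on_disc f,
         power_series_on_disc f A,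
         A 0%N = a0 *: id_op,
         `|a0| < 1
       & forall z, unit_disc R z -> opnorm (f z) <= 1]
     /\ ~ (bohr_sum f A r <= 1)%E).
Proof.
split=> [f A a0 _ _ fA A0 a01 f1 r r03|Hn0 r /andP[r3 r1]].
  apply: bohr_sum_le1 => //; first by rewrite (power_series_at0 _ _ _ _ fA).
    by rewrite -(power_series_at0 _ _ _ _ fA) f1// /unit_disc/= normr0.
  (* On the zero space [A 0] has norm 0 rather than [|a0|], so the case is separated; there all
     operator norms vanish. *)
  move=> k k0; have [Hn0|H0] := pselect (exists x : H, x != 0).
    by rewrite A0 opnorm_scalar//; apply: opnorm_coef_le f1 k0.
  by rewrite !opnorm_trivial// expr0n subr0.
(* The midpoint of [1] and of [(r^-1 - 1) / 2], where [r * (1 + 2 * a) = 1]. *)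
pose a := (1 + r^-1) / 4.
have r0 : 0 < r by lra.
have ir3 : r^-1 < 3 by rewrite invf_plt ?posrE.
have ir1 : 1 < r^-1 by rewrite invf_gt1.
have a0 : 0 < a by rewrite /a; lra.
have a1 : a < 1 by rewrite /a; lra.
exists (fun z => blaschke R a z *: id_op), (fun n => blaschke_coef R a n *: id_op), (a%:C)%C.
split; first split => //.
- exact: holomorphic_blaschke.
- exact: power_series_blaschke.
- by rewrite gtr0_norm ltcR.
- move=> z z1; rewrite (le_trans (opnorm_scalar_le _ _ _))// -lecR Re_normC.
  exact: norm_blaschke_le1.
apply: bohr_sum_blaschke_gt1 => //; first by rewrite r0.
(* For the chosen [a], [r * (1 + 2 * a)] is the mean of [3 * r] and 1, which exceeds 1 exactly when
   [r > 1/3]. *)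
rewrite (_ : r * _ = (3 * r + 1) / 2); first by rewrite ltr_pdivlMr//; lra.
by rewrite /a; field; rewrite gt_eqF.
Qed.
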